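(* Let $n=1$, let $V_1,V_2\in C(\mathbb{T})$ and $H_i(\xi,p)=|p|^2-V_i(\xi)$ for $i=1,2$. Assume that $V_1\equiv0$, $V_2\ge0$ on $[0,1]$ and $\{V_2=0\}=\{1/2\}$. Then there exists $\gamma>0$ such that $\overline{H}(P)=0$ for all $P\in\mathbb{R}$ with $|P|\le\gamma$.
   Context: $\mathbb{T}=\mathbb{R}/\mathbb{Z}$ is identified with $[0,1]$ (endpoints glued), and functions on $\mathbb{T}$ are identified with $1$-periodic functions on $\mathbb{R}$. Effective Hamiltonian: for each $P\in\mathbb{R}$ it is known that there is a unique constant $\overline{H}(P)$ such that the cell problem $$H_1(\xi,P+Dv_1(\xi))+v_1(\xi)-v_2(\xi)=\overline{H}(P),\qquad H_2(\xi,P+Dv_2(\xi))+v_2(\xi)-v_1(\xi)=\overline{H}(P)\quad\text{in }\mathbb{T}$$ admits a continuous viscosity solution $(v_1,v_2)\in C(\mathbb{T})^2$ (viscosity inequalities are imposed on each component with the other component inserted as a given function). *)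

(* Defs.v *)
From Stdlib Require Import Reals.
From Coquelicot Require Import Coquelicot.
Open Scope R_scope.

(** Functions on the torus [R/Z] are represented by 1-periodic functions on [R]. *)

Definition periodic (f : R -> R) : Prop := forall x : R, f (x + 1) = f x.

Definition C0_torus (f : R -> R) : Prop :=
  periodic f /\ forall x : R, continuous f x.

Definition C1_torus (f : R -> R) : Prop :=
  periodic f /\ (forall x : R, ex_derive f x) /\
  forall x : R, continuous (Derive f) x.

Definition local_max (f : R -> R) (x0 : R) : Prop :=
  locally x0 (fun x => f x <= f x0).

Definition local_min (f : R -> R) (x0 : R) : Prop :=
  locally x0 (fun x => f x0 <= f x).

(** Viscosity solutions of the scalar equation [F (x, v(x), Dv(x)) = 0] on the
    torus; the arguments of [F] are the point, the value and the gradient. *)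

Definition viscosity_subsolution (F : R -> R -> R -> R) (v : R -> R) : Prop :=
  forall (phi : R -> R) (x0 : R),
    C1_torus phi -> local_max (fun x => v x - phi x) x0 ->
    F x0 (v x0) (Derive phi x0) <= 0.

Definition viscosity_supersolution (F : R -> R -> R -> R) (v : R -> R) : Prop :=
  forall (phi : R -> R) (x0 : R),
    C1_torus phi -> local_min (fun x => v x - phi x) x0 ->
    0 <= F x0 (v x0) (Derive phi x0).

Definition viscosity_solution (F : R -> R -> R -> R) (v : R -> R) : Prop :=
  viscosity_subsolution F v /\ viscosity_supersolution F v.

(** [H(x, P + Dv) + v - w = c], as an equation for [v] with [w] a given function. *)
Definition cell_equation (H : R -> R -> R) (P c : R) (w : R -> R)
    (x r p : R) : R :=
  H x (P + p) + r - w x - c.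

Definition cell_solution (H1 H2 : R -> R -> R) (P c : R) (v1 v2 : R -> R) : Prop :=
  C0_torus v1 /\ C0_torus v2 /\
  viscosity_solution (cell_equation H1 P c v2) v1 /\
  viscosity_solution (cell_equation H2 P c v1) v2.

Definition cell_solvable (H1 H2 : R -> R -> R) (P c : R) : Prop :=
  exists v1 v2 : R -> R, cell_solution H1 H2 P c v1 v2.

(** The value of the effective Hamiltonian at [P] is [c]: this is stated as a
    relation, [c] being the unique constant for which the cell problem is
    solvable, so that no default value is involved. *)
Definition effective_hamiltonian_is (H1 H2 : R -> R -> R) (P c : R) : Prop :=
  unique (cell_solvable H1 H2 P) c.

Definition quadratic_hamiltonian (V : R -> R) (x p : R) : R :=
  Rabs p ^ 2 - V x.

(* Main.v *)
Require Import Defs.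
From Stdlib Require Import Reals Lra Classical IndefiniteDescription.
From Coquelicot Require Import Coquelicot.
Open Scope R_scope.

(** Uniqueness of the constant: double the variables. The Hamiltonians are [|p|^2 - V_i(x)],
    so at a maximum over [i], [x], [y] of the penalized difference of two solutions the
    gradient terms cancel, the coupling terms have the right sign, and only
    [V_i(x) - V_i(y)] remains.

    Solvability with constant [0]: at the zero [z = 1/2] of both potentials, any pair with
    [v1 z = v2 z] satisfies the supersolution inequality. Hence the largest subsolution
    vanishing at [z], if there is one, is a solution: away from [z] Perron's bump argument
    applies. For small [P] such a subsolution is given by [P + v1' = q c] and
    [v2 - v1 = k^2 c^2], where [c = max (0, cos (2 PI x))] lives where [V2] is bounded below
    by a constant much larger than [k], and [q] is [P] divided by the mean of [c]. *)

(** * Continuity in epsilon-delta form *)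

Lemma continuous_eps_iff (f : R -> R) (x : R) :
  continuous f x <->
  forall eps, 0 < eps ->
    exists del, 0 < del /\ forall y, Rabs (y - x) < del -> Rabs (f y - f x) < eps.
Proof.
  split.
  - intros Hf eps Heps.
    destruct (proj1 (filterlim_locally f (f x)) Hf (mkposreal eps Heps)) as [d Hd].
    exists d; split; [apply cond_pos |]. intros y Hy. exact (Hd y Hy).
  - intros H. apply filterlim_locally. intros eps.
    destruct (H eps (cond_pos eps)) as (d & Hd & Hd').
    exists (mkposreal d Hd). intros y Hy. exact (Hd' y Hy).
Qed.

Lemma continuous_continuity_pt (f : R -> R) (x : R) : continuous f x -> continuity_pt f x.
Proof. intros H. apply continuity_pt_filterlim. exact H. Qed.

Lemma continuous_Rmax (f g : R -> R) (x : R) :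
  continuous f x -> continuous g x -> continuous (fun y => Rmax (f y) (g y)) x.
Proof.
  intros Hf Hg. apply continuous_eps_iff. intros eps Heps.
  destruct (proj1 (continuous_eps_iff f x) Hf eps Heps) as (d1 & Hd1 & H1).
  destruct (proj1 (continuous_eps_iff g x) Hg eps Heps) as (d2 & Hd2 & H2).
  exists (Rmin d1 d2); split; [apply Rmin_pos; assumption |].
  intros y Hy.
  assert (Rmin d1 d2 <= d1) by apply Rmin_l. assert (Rmin d1 d2 <= d2) by apply Rmin_r.
  specialize (H1 y ltac:(lra)). specialize (H2 y ltac:(lra)).
  apply Rabs_def2 in H1. apply Rabs_def2 in H2. apply Rabs_def1;
  unfold Rmax; repeat destruct Rle_dec; lra.
Qed.

Lemma is_derive_continuous (f : R -> R) (x l : R) : is_derive f x l -> continuous f x.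
Proof. intros H. apply (ex_derive_continuous f). exists l. exact H. Qed.

(** * Periodic functions *)

Lemma periodic_IZR (f : R -> R) : periodic f -> forall (k : Z) (x : R), f (x + IZR k) = f x.
Proof.
  intros Hf. refine (Z.peano_ind _ _ _ _).
  - intros x. f_equal. lra.
  - intros k IH x. rewrite succ_IZR, <- Rplus_assoc, Hf. apply IH.
  - intros k IH x. rewrite <- (Hf (x + IZR (Z.pred k))), <- (IH x). f_equal.
    rewrite <- Z.sub_1_r, minus_IZR. lra.
Qed.

Lemma nearest_representative (x x0 : R) : exists k : Z, Rabs (x + IZR k - x0) <= 1 / 2.
Proof.
  exists (- Int_part (x - x0 + 1 / 2))%Z. rewrite opp_IZR.
  destruct (base_Int_part (x - x0 + 1 / 2)). apply Rabs_le. lra.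
Qed.

Lemma C0_torus_max (f : R -> R) : C0_torus f -> exists x0, forall x, f x <= f x0.
Proof.
  intros [Hp Hc].
  destruct (continuity_ab_maj f (-1) 1 ltac:(lra)
    ltac:(intros; apply continuous_continuity_pt, Hc)) as (x0 & H & _).
  exists x0. intros x. destruct (nearest_representative x 0) as [k Hk].
  rewrite <- (periodic_IZR f Hp k x). apply H. apply Rabs_le_between in Hk. lra.
Qed.

Lemma C0_torus_opp (f : R -> R) : C0_torus f -> C0_torus (fun x => - f x).
Proof.
  intros [Hp Hc]. split.
  - intros x. now rewrite Hp.
  - intros x. apply (continuous_opp f), Hc.
Qed.

Lemma C0_torus_plus (f g : R -> R) :
  C0_torus f -> C0_torus g -> C0_torus (fun x => f x + g x).
Proof.
  intros [Hp Hc] [Hp' Hc']. split.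
  - intros x. now rewrite Hp, Hp'.
  - intros x. now apply (continuous_plus f g).
Qed.

Lemma C0_torus_max_fun (f g : R -> R) :
  C0_torus f -> C0_torus g -> C0_torus (fun x => Rmax (f x) (g x)).
Proof.
  intros [Hp Hc] [Hp' Hc']. split.
  - intros x. now rewrite Hp, Hp'.
  - intros x. now apply continuous_Rmax.
Qed.

Lemma C0_torus_bounded (f : R -> R) :
  C0_torus f -> exists M, 0 < M /\ forall x, Rabs (f x) <= M.
Proof.
  intros Hf.
  destruct (C0_torus_max f Hf) as [a Ha].
  destruct (C0_torus_max _ (C0_torus_opp f Hf)) as [b Hb].
  exists (Rabs (f a) + Rabs (f b) + 1).
  assert (H1 := Rle_abs (f a)). assert (H2 := Rle_abs (- f b)). rewrite Rabs_Ropp in H2.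
  assert (H3 := Rabs_pos (f a)). assert (H4 := Rabs_pos (f b)).
  split; [lra |]. intros x. specialize (Ha x). specialize (Hb x). apply Rabs_le. lra.
Qed.

(** * A periodic substitute for the quadratic penalization *)

(* [1 - cos (2 PI t)] plays the role of [t ^ 2]: test functions have to be periodic. *)
Definition penalty (t : R) : R := 1 - cos (2 * PI * t).

Lemma penalty_derive (x0 x : R) :
  is_derive (fun y => penalty (y - x0)) x (2 * PI * sin (2 * PI * (x - x0))).
Proof. unfold penalty. auto_derive; [exact I | unfold Rminus; ring]. Qed.

Lemma penalty_periodic : periodic penalty.
Proof.
  intros x. unfold penalty. replace (2 * PI * (x + 1)) with (2 * PI * x + 2 * PI) by ring.
  now rewrite cos_plus, cos_2PI, sin_2PI, Rmult_0_r, Rmult_1_r, Rminus_0_r.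
Qed.

Lemma penalty_0 : penalty 0 = 0.
Proof. unfold penalty. rewrite Rmult_0_r, cos_0. ring. Qed.

Lemma penalty_ge0 (t : R) : 0 <= penalty t.
Proof. unfold penalty. destruct (COS_bound (2 * PI * t)). lra. Qed.

Lemma penalty_lipschitz (s t : R) : Rabs (penalty s - penalty t) <= 2 * PI * Rabs (s - t).
Proof.
  destruct (MVT_gen penalty t s (fun x => 2 * PI * sin (2 * PI * x))) as (c & _ & Hc).
  - intros x _. unfold penalty. auto_derive; [exact I | ring].
  - intros x _. apply continuous_continuity_pt.
    apply (ex_derive_continuous penalty). unfold penalty. auto_derive. exact I.
  - rewrite Hc, Rabs_mult. apply Rmult_le_compat_r; [apply Rabs_pos |].
    rewrite Rabs_mult. destruct (SIN_bound (2 * PI * c)). assert (H1 := PI_RGT_0).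
    rewrite (Rabs_pos_eq (2 * PI)) by lra.
    assert (Rabs (sin (2 * PI * c)) <= 1) by (apply Rabs_le; lra). nra.
Qed.

(** Cosine is even, and decreasing on [[0, PI]], so up to half a period the penalty grows with the
    distance. *)
Lemma penalty_gap (r t : R) : 0 <= r -> r <= Rabs t <= 1 / 2 -> penalty r <= penalty t.
Proof.
  intros Hr Ht. unfold penalty. assert (H1 := PI_RGT_0).
  assert (E : cos (2 * PI * t) = cos (2 * PI * Rabs t)).
  { unfold Rabs. destruct Rcase_abs; [| reflexivity].
    rewrite <- cos_neg. f_equal. ring. }
  rewrite E. enough (cos (2 * PI * Rabs t) <= cos (2 * PI * r)) by lra.
  apply cos_decr_1; nra.
Qed.

Lemma penalty_gt0 (r : R) : 0 < r <= 1 / 2 -> 0 < penalty r.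
Proof.
  intros Hr. unfold penalty. assert (H1 := PI_RGT_0). rewrite <- cos_0 at 1.
  enough (cos (2 * PI * r) < cos 0) by lra.
  apply cos_decreasing_1; nra.
Qed.

(** The penalty controls the distance on the torus, hence the integer translation in the
    conclusion. *)
Lemma penalty_small_near (r : R) :
  0 < r -> exists s, 0 < s /\
    forall x x0, penalty (x - x0) < s -> exists k : Z, Rabs (x + IZR k - x0) < r.
Proof.
  intros Hr.
  assert (Hm : 0 < Rmin r (1 / 2) <= 1 / 2).
  { split; [apply Rmin_pos; lra | apply Rmin_r]. }
  exists (penalty (Rmin r (1 / 2))). split; [now apply penalty_gt0 |].
  intros x x0 H. destruct (nearest_representative x x0) as [k Hk]. exists k.
  apply Rnot_le_lt. intros Hc.
  assert (penalty (Rmin r (1 / 2)) <= penalty (x + IZR k - x0)).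
  { apply penalty_gap; [lra |]. assert (H1 := Rmin_l r (1 / 2)). lra. }
  replace (x + IZR k - x0) with (x - x0 + IZR k) in * by ring.
  rewrite (periodic_IZR penalty penalty_periodic) in *. lra.
Qed.

Lemma C0_torus_penalty_continuous (f : R -> R) :
  C0_torus f -> forall eps, 0 < eps ->
  exists s, 0 < s /\ forall x y, penalty (x - y) < s -> Rabs (f x - f y) < eps.
Proof.
  intros [Hp Hc] eps Heps.
  (* The representative of [y] is taken in [[-1/2, 1/2]] and that of [x] within distance 1 of it, so
     both lie in [[-2, 2]]. *)
  destruct (@Heine_cor2 f (-2) 2 ltac:(intros; apply continuous_continuity_pt, Hc)
    (mkposreal eps Heps)) as [d Hd].
  assert (Hd0 : 0 < Rmin d 1) by (apply Rmin_pos; [apply cond_pos | lra]).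
  destruct (penalty_small_near _ Hd0) as (s & Hs & H).
  exists s; split; [exact Hs |]. intros x y Hxy.
  destruct (nearest_representative y 0) as [l Hl].
  destruct (H x (y + IZR l)) as [k Hk].
  { replace (x - (y + IZR l)) with (x - y + IZR (- l)) by (rewrite opp_IZR; ring).
    now rewrite (periodic_IZR penalty penalty_periodic). }
  rewrite <- (periodic_IZR f Hp k x), <- (periodic_IZR f Hp l y).
  assert (H1 := Rmin_l d 1). assert (H2 := Rmin_r d 1).
  apply Rabs_le_between in Hl.
  apply Hd; [| lra | lra]. apply Rabs_lt_between in Hk. lra.
Qed.

Lemma penalty_test (K x0 : R) :
  C1_torus (fun x => K * penalty (x - x0)) /\
  forall x, Derive (fun x => K * penalty (x - x0)) x = K * (2 * PI * sin (2 * PI * (x - x0))).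
Proof.
  assert (D : forall x, is_derive (fun x => K * penalty (x - x0)) x
    (K * (2 * PI * sin (2 * PI * (x - x0))))).
  { intros x. apply (is_derive_scal (fun x => penalty (x - x0)) x K), penalty_derive. }
  split; [| intros x; apply is_derive_unique, D].
  repeat split.
  - intros x. replace (x + 1 - x0) with (x - x0 + 1) by ring.
    now rewrite penalty_periodic.
  - intros x. eexists. apply D.
  - intros x. apply continuous_ext with (fun x => K * (2 * PI * sin (2 * PI * (x - x0)))).
    { intros y. symmetry. apply is_derive_unique, D. }
    apply (ex_derive_continuous (fun x => K * (2 * PI * sin (2 * PI * (x - x0))))).
    auto_derive. exact I.
Qed.

(** * Uniqueness of the ergodic constant *)

(** Iterated one-variable maximization: a maximizer [X y] in the first variable is chosen for each
    [y], and the resulting value is again a continuous periodic function of [y]. *)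
Lemma doubled_max (v w : R -> R) (K : R) :
  C0_torus v -> C0_torus w -> 0 <= K ->
  exists x y, forall x' y',
    v x' - w y' - K * penalty (x' - y') <= v x - w y - K * penalty (x - y).
Proof.
  intros Hv Hw HK.
  assert (HX : forall y, exists x, forall x',
    v x' - K * penalty (x' - y) <= v x - K * penalty (x - y)).
  { intros y. apply (C0_torus_max (fun x => v x - K * penalty (x - y))). split.
    - intros x. rewrite (proj1 Hv). replace (x + 1 - y) with (x - y + 1) by ring.
      now rewrite penalty_periodic.
    - intros x. apply (continuous_minus v (fun x => K * penalty (x - y))).
      + apply Hv.
      + eapply is_derive_continuous.
        apply (is_derive_scal (fun x => penalty (x - y)) x K), penalty_derive. }
  destruct (functional_choice _ HX) as [X HX'].
  assert (Hm : C0_torus (fun y => v (X y) - K * penalty (X y - y) - w y)).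
  { split.
    - intros y. rewrite (proj1 Hw). f_equal.
      assert (H1 := HX' y (X (y + 1))). assert (H2 := HX' (y + 1) (X y)).
      replace (X (y + 1) - y) with (X (y + 1) - (y + 1) + 1) in H1 by ring.
      rewrite <- (penalty_periodic (X y - (y + 1))) in H2.
      replace (X y - (y + 1) + 1) with (X y - y) in H2 by ring.
      rewrite penalty_periodic in H1. lra.
    - intros y0. apply (continuous_minus (fun y => v (X y) - K * penalty (X y - y)) w);
        [| apply Hw].
      (* Each of [X y] and [X y0] competes at the other point, so the partial maximum inherits the
         Lipschitz constant [K * (2 * PI)] of the penalty. The added 1 keeps the denominator
         positive when [K = 0]. *)
      apply continuous_eps_iff. intros eps Heps.
      assert (HPI := PI_RGT_0).
      assert (HKP : 0 < K * (2 * PI) + 1) by nra.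
      exists (eps / (K * (2 * PI) + 1)). split; [now apply Rdiv_lt_0_compat |].
      intros y Hy.
      apply Rlt_div_r in Hy; [| exact HKP].
      assert (H1 := HX' y (X y0)). assert (H2 := HX' y0 (X y)).
      assert (H3 := penalty_lipschitz (X y0 - y) (X y0 - y0)).
      assert (H4 := penalty_lipschitz (X y - y) (X y - y0)).
      replace (X y0 - y - (X y0 - y0)) with (- (y - y0)) in H3 by ring.
      replace (X y - y - (X y - y0)) with (- (y - y0)) in H4 by ring.
      rewrite Rabs_Ropp in H3, H4. assert (H5 := Rabs_pos (y - y0)).
      apply Rabs_le_between in H3, H4.
      apply Rabs_def1; nra. }
  destruct (C0_torus_max _ Hm) as [y Hy].
  exists (X y), y. intros x' y'. specialize (Hy y'). specialize (HX' y' x'). simpl in Hy. lra.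
Qed.

(* The penalization has the same gradient in both variables at a maximum point, so the
   gradient terms of the two inequalities are equal and cancel. *)
Lemma doubled_max_bound (V v w v' w' : R -> R) (P K c c' x y : R) :
  viscosity_subsolution (cell_equation (quadratic_hamiltonian V) P c w) v ->
  viscosity_supersolution (cell_equation (quadratic_hamiltonian V) P c' w') v' ->
  (forall x' y',
    v x' - v' y' - K * penalty (x' - y') <= v x - v' y - K * penalty (x - y)) ->
  w x - w' y <= v x - v' y ->
  c' - c <= V x - V y.
Proof.
  intros Hsub Hsup Hmax Hle.
  assert (pen_sym : forall s t, penalty (s - t) = penalty (t - s)).
  { intros s t. unfold penalty. rewrite <- cos_neg. f_equal. f_equal. ring. }
  destruct (penalty_test K y) as [T1 D1].
  destruct (penalty_test (- K) x) as [T2 D2].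
  assert (H1 := Hsub (fun x => K * penalty (x - y)) x T1).
  assert (H2 := Hsup (fun t => - K * penalty (t - x)) y T2).
  rewrite D1 in H1. rewrite D2 in H2.
  replace (- K * (2 * PI * sin (2 * PI * (y - x)))) with
    (K * (2 * PI * sin (2 * PI * (x - y)))) in H2.
  2:{ replace (2 * PI * (y - x)) with (- (2 * PI * (x - y))) by ring. rewrite sin_neg. ring. }
  unfold cell_equation, quadratic_hamiltonian in H1, H2.
  assert (L1 : local_max (fun x => v x - K * penalty (x - y)) x).
  { exists (mkposreal 1 Rlt_0_1). intros t _. specialize (Hmax t y). lra. }
  assert (L2 : local_min (fun t => v' t - - K * penalty (t - x)) y).
  { exists (mkposreal 1 Rlt_0_1). intros t _. specialize (Hmax x t).
    rewrite (pen_sym t x), (pen_sym y x). lra. }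
  specialize (H1 L1). specialize (H2 L2). lra.
Qed.

(** If [c < c'], a large [K] brings the doubled points so close that both potentials vary by less
    than [c' - c] between them, against the bound of [doubled_max_bound]. *)
Lemma cell_constant_le (V1 V2 : R -> R) (P c c' : R) :
  C0_torus V1 -> C0_torus V2 ->
  cell_solvable (quadratic_hamiltonian V1) (quadratic_hamiltonian V2) P c ->
  cell_solvable (quadratic_hamiltonian V1) (quadratic_hamiltonian V2) P c' ->
  c' <= c.
Proof.
  intros HV1 HV2 (v1 & v2 & Hv1 & Hv2 & [S1 _] & [S2 _])
    (w1 & w2 & Hw1 & Hw2 & [_ T1] & [_ T2]).
  apply Rnot_lt_le. intros Hc.
  destruct (C0_torus_penalty_continuous V1 HV1 (c' - c) ltac:(lra)) as (s1 & Hs1 & U1).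
  destruct (C0_torus_penalty_continuous V2 HV2 (c' - c) ltac:(lra)) as (s2 & Hs2 & U2).
  destruct (C0_torus_bounded w1 Hw1) as (B1 & HB1 & B1').
  destruct (C0_torus_bounded w2 Hw2) as (B2 & HB2 & B2').
  set (s := Rmin s1 s2).
  assert (Hs : 0 < s) by (apply Rmin_pos; assumption).
  assert (s <= s1) by apply Rmin_l. assert (s <= s2) by apply Rmin_r.
  (* Comparing the maximum at [(x, y)] with the value at [(x, x)] gives [K * penalty (x - y) <= w x
     - w y <= 2 * (B1 + B2) < K * s]. *)
  set (K := (2 * (B1 + B2) + 1) / s).
  assert (HK : K * s = 2 * (B1 + B2) + 1) by (unfold K; field; lra).
  assert (HK0 : 0 < K) by (apply Rdiv_lt_0_compat; lra).
  assert (close : forall (v w : R -> R) x y,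
    (forall z, Rabs (w z) <= B1 + B2) ->
    (forall x' y', v x' - w y' - K * penalty (x' - y') <= v x - w y - K * penalty (x - y)) ->
    penalty (x - y) < s).
  { intros v w x y Hw Hmax. specialize (Hmax x x).
    replace (x - x) with 0 in Hmax by ring. rewrite penalty_0 in Hmax.
    assert (Hx := Hw x). assert (Hy := Hw y). apply Rabs_le_between in Hx, Hy.
    apply Rmult_lt_reg_l with K; lra. }
  destruct (doubled_max v1 w1 K Hv1 Hw1 ltac:(lra)) as (x1 & y1 & M1).
  destruct (doubled_max v2 w2 K Hv2 Hw2 ltac:(lra)) as (x2 & y2 & M2).
  assert (C1 : penalty (x1 - y1) < s)
    by (apply (close v1 w1); [intros z; specialize (B1' z); lra | exact M1]).
  assert (C2 : penalty (x2 - y2) < s)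
    by (apply (close v2 w2); [intros z; specialize (B2' z); lra | exact M2]).
  (* The component with the larger doubled maximum is used: at its maximum point the other penalized
     difference is no larger, which gives the coupling term the right sign. *)
  destruct (Rle_dec (v2 x2 - w2 y2 - K * penalty (x2 - y2))
                    (v1 x1 - w1 y1 - K * penalty (x1 - y1))) as [Hd | Hd].
  - assert (E := doubled_max_bound V1 v1 v2 w1 w2 P K c c' x1 y1 S1 T1 M1).
    specialize (M2 x1 y1). specialize (E ltac:(lra)).
    specialize (U1 x1 y1 ltac:(lra)). apply Rabs_def2 in U1. lra.
  - assert (E := doubled_max_bound V2 v2 v1 w2 w1 P K c c' x2 y2 S2 T2 M2).
    specialize (M1 x2 y2). specialize (E ltac:(lra)).
    specialize (U2 x2 y2 ltac:(lra)). apply Rabs_def2 in U2. lra.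
Qed.

(** * Subsolutions in terms of descending slopes *)

(* At each point, the descending slope of [v x + P x] is at most [sqrt (V + w - v)].
   In one dimension this is equivalent to being a subsolution of
   [|P + Dv|^2 - V + v - w = 0], and no test function is involved. *)
Definition slope_subsolution (P : R) (V w v : R -> R) : Prop :=
  forall b : R, 0 <= V b + w b - v b /\
    forall eps, 0 < eps -> exists h, 0 < h /\ forall a, Rabs (b - a) < h ->
      v b - v a + P * (b - a) <= (sqrt (V b + w b - v b) + eps) * Rabs (b - a).

(** [W t - (C + e') * t] attains its maximum over [[x, y]] at [x]: at a maximum point further right,
    the slope towards the left would be at least [C + e'], while the hypothesis allows only
    [C + e' / 2]. *)
Lemma le_of_slope_left (W : R -> R) (C x y : R) :
  x <= y -> (forall t, continuous W t) ->
  (forall b, x <= b <= y -> forall eps, 0 < eps ->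
    exists h, 0 < h /\ forall a, Rabs (b - a) < h -> W b - W a <= (C + eps) * Rabs (b - a)) ->
  W y - W x <= C * (y - x).
Proof.
  intros Hxy Hc H.
  apply le_epsilon. intros e He.
  set (e' := e / (y - x + 1)).
  assert (He' : 0 < e') by (apply Rdiv_lt_0_compat; lra).
  assert (Ee : e' * (y - x + 1) = e) by (unfold e'; field; lra).
  destruct (continuity_ab_maj (fun t => W t - (C + e') * t) x y Hxy) as (b & Hb & Hbxy).
  { intros t _. apply continuous_continuity_pt.
    apply (continuous_minus W (fun t => (C + e') * t)); [apply Hc |].
    apply (ex_derive_continuous (fun t => (C + e') * t)). auto_derive. exact I. }
  destruct (Req_dec b x) as [E | E].
  - subst b. specialize (Hb y ltac:(lra)). simpl in Hb. nra.
  - destruct (H b Hbxy (e' / 2) ltac:(lra)) as (h & Hh & Hs).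
    set (a := Rmax x (b - h / 2)).
    assert (Ha : x <= a < b) by (split; [apply Rmax_l | apply Rmax_lub_lt; lra]).
    assert (Ha' : b - h / 2 <= a) by apply Rmax_r.
    assert (Hab : Rabs (b - a) = b - a) by (apply Rabs_pos_eq; lra).
    specialize (Hs a). rewrite Hab in Hs. specialize (Hs ltac:(lra)).
    specialize (Hb a ltac:(lra)). simpl in Hb. nra.
Qed.

Lemma le_of_slope (W : R -> R) (C x y : R) :
  (forall t, continuous W t) ->
  (forall b, Rmin x y <= b <= Rmax x y -> forall eps, 0 < eps ->
    exists h, 0 < h /\ forall a, Rabs (b - a) < h -> W b - W a <= (C + eps) * Rabs (b - a)) ->
  W y - W x <= C * Rabs (y - x).
Proof.
  intros Hc H. destruct (Rle_dec x y) as [Hxy | Hxy].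
  - rewrite Rabs_pos_eq by lra. apply le_of_slope_left; [exact Hxy | exact Hc |].
    intros b Hb. apply H. rewrite Rmin_left, Rmax_right by lra. exact Hb.
  - rewrite Rabs_left by lra.
    assert (E := le_of_slope_left (fun t => W (- t)) C (- x) (- y) ltac:(lra)).
    cbv beta in E. rewrite !Ropp_involutive in E.
    replace (- (y - x)) with (- y - - x) by ring. apply E.
    + intros t. apply (continuous_comp Ropp W); [| apply Hc].
      apply (ex_derive_continuous Ropp). auto_derive. exact I.
    + intros b Hb eps Heps. destruct (H (- b)) with (eps := eps) as (h & Hh & Hs).
      { rewrite Rmin_right, Rmax_left by lra. lra. }
      { exact Heps. }
      exists h; split; [exact Hh |]. intros a Ha. specialize (Hs (- a)).
      replace (- b - - a) with (- (b - a)) in Hs by ring. rewrite Rabs_Ropp in Hs.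
      apply Hs, Ha.
Qed.

(** Integrated form of the slope condition, free of infinitesimal quantifiers and therefore suited
    to passing to a supremum. *)
Lemma slope_subsolution_le (P m : R) (V w v : R -> R) (x y : R) :
  (forall t, continuous v t) -> slope_subsolution P V w v ->
  (forall t, Rmin x y <= t <= Rmax x y -> V t + w t - v t <= m) ->
  v y - v x + P * (y - x) <= sqrt m * Rabs (y - x).
Proof.
  intros Hc Hs Hm.
  replace (v y - v x + P * (y - x)) with ((v y + P * y) - (v x + P * x)) by ring.
  apply (le_of_slope (fun t => v t + P * t)).
  - intros t. apply (continuous_plus v (fun t => P * t)); [apply Hc |].
    apply (ex_derive_continuous (fun t => P * t)). auto_derive. exact I.
  - intros b Hb eps Heps. destruct (Hs b) as [_ H].
    destruct (H eps Heps) as (h & Hh & H'). exists h; split; [exact Hh |].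
    intros a Ha. specialize (H' a Ha).
    assert (sqrt (V b + w b - v b) <= sqrt m) by (apply sqrt_le_1_alt, Hm, Hb).
    assert (H1 := Rabs_pos (b - a)). nra.
Qed.

(** Coercivity in the gradient. The constant depends on [m] and [P] only, so it serves a whole
    family of subsolutions. *)
Lemma slope_subsolution_lipschitz (P m : R) (V w v : R -> R) :
  (forall t, continuous v t) -> slope_subsolution P V w v ->
  (forall t, V t + w t - v t <= m) ->
  forall x y, Rabs (v y - v x) <= (sqrt m + Rabs P) * Rabs (y - x).
Proof.
  intros Hc Hs Hm x y.
  assert (H1 := slope_subsolution_le P m V w v x y Hc Hs ltac:(intros; apply Hm)).
  assert (H2 := slope_subsolution_le P m V w v y x Hc Hs ltac:(intros; apply Hm)).
  rewrite Rabs_minus_sym in H2.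
  assert (H3 := Rabs_mult P (y - x)).
  assert (H4 := Rle_abs (P * (y - x))). assert (H5 := Rle_abs (- (P * (y - x)))).
  rewrite Rabs_Ropp in H5. apply Rabs_le. lra.
Qed.

(** * From derivatives to slopes, and from slopes to viscosity subsolutions *)

Lemma is_derive_slope_bound (f : R -> R) (x l : R) :
  is_derive f x l -> forall eps, 0 < eps -> exists h, 0 < h /\
    forall a, Rabs (x - a) < h -> Rabs (f x - f a - l * (x - a)) <= eps * Rabs (x - a).
Proof.
  intros H eps Heps. apply is_derive_Reals in H.
  destruct (H eps Heps) as [d Hd]. exists d. split; [apply cond_pos |].
  intros a Ha. destruct (Req_dec a x) as [-> | E].
  - replace (f x - f x - l * (x - x)) with 0 by ring. rewrite Rminus_diag, Rabs_R0. lra.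
  - assert (E' : a - x <> 0) by lra. rewrite Rabs_minus_sym in Ha.
    specialize (Hd (a - x) E' Ha). replace (x + (a - x)) with a in Hd by ring.
    replace (f x - f a - l * (x - a)) with (- (((f a - f x) / (a - x) - l) * (a - x)))
      by (field; exact E').
    rewrite Rabs_Ropp, Rabs_mult, (Rabs_minus_sym x a).
    apply Rmult_le_compat_r; [apply Rabs_pos | lra].
Qed.

(** Touching from below gives [v b - v a <= f b - f a], so descending slopes of [v] are bounded by
    those of [f]. This serves classical subsolutions and the bump in Perron's argument. *)
Lemma slope_of_touching (f v : R -> R) (P l b F : R) :
  is_derive f b l -> (P + l) ^ 2 <= F -> v b = f b -> (forall a, f a <= v a) ->
  forall eps, 0 < eps -> exists h, 0 < h /\ forall a, Rabs (b - a) < h ->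
    v b - v a + P * (b - a) <= (sqrt F + eps) * Rabs (b - a).
Proof.
  intros Hd HF Hb Hle eps Heps.
  destruct (is_derive_slope_bound f b l Hd eps Heps) as (h & Hh & H).
  exists h; split; [exact Hh |]. intros a Ha. specialize (H a Ha). specialize (Hle a).
  apply Rabs_le_between in H.
  assert (Hs : Rabs (P + l) <= sqrt F).
  { rewrite <- sqrt_Rsqr_abs. apply sqrt_le_1_alt. unfold Rsqr. lra. }
  assert ((P + l) * (b - a) <= sqrt F * Rabs (b - a)).
  { apply Rle_trans with (1 := Rle_abs _). rewrite Rabs_mult.
    apply Rmult_le_compat_r; [apply Rabs_pos | exact Hs]. }
  rewrite Hb. lra.
Qed.

Lemma classical_slope_subsolution (P : R) (V w v dv : R -> R) :
  (forall x, is_derive v x (dv x)) ->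
  (forall x, (P + dv x) ^ 2 <= V x + w x - v x) ->
  slope_subsolution P V w v.
Proof.
  intros Hd H b. split.
  - apply Rle_trans with (2 := H b). apply pow2_ge_0.
  - apply (slope_of_touching v v P (dv b)); auto using Rle_refl.
Qed.

(** At a maximum of [v - phi], descents of [phi] are bounded by descents of [v]. Steps of length [h]
    to the left and to the right bound [P + Derive phi x0] from both sides. *)
Lemma slope_subsolution_viscosity (P : R) (V w v : R -> R) :
  slope_subsolution P V w v ->
  viscosity_subsolution (cell_equation (quadratic_hamiltonian V) P 0 w) v.
Proof.
  intros Hs phi x0 (_ & Hd & _) [d Hmax]. destruct (Hs x0) as [HF Hsl].
  unfold cell_equation, quadratic_hamiltonian.
  set (F := V x0 + w x0 - v x0) in *.
  enough (Hq : Rabs (P + Derive phi x0) <= sqrt F).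
  { assert (Rabs (P + Derive phi x0) ^ 2 <= sqrt F ^ 2).
    { apply pow_incr. split; [apply Rabs_pos | exact Hq]. }
    rewrite pow2_sqrt in H by exact HF. unfold F in H. lra. }
  apply le_epsilon. intros e He.
  destruct (Hsl (e / 2) ltac:(lra)) as (h1 & Hh1 & H1).
  destruct (is_derive_slope_bound phi x0 _ (Derive_correct phi x0 (Hd x0)) (e / 2) ltac:(lra))
    as (h2 & Hh2 & H2).
  set (h := Rmin d (Rmin h1 h2) / 2).
  assert (Hh : 0 < h).
  { assert (0 < Rmin d (Rmin h1 h2)) by (repeat apply Rmin_pos; auto using cond_pos).
    unfold h. lra. }
  assert (Hle : h < d /\ h < h1 /\ h < h2).
  { assert (A1 := Rmin_l d (Rmin h1 h2)). assert (A2 := Rmin_r d (Rmin h1 h2)).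
    assert (A3 := Rmin_l h1 h2). assert (A4 := Rmin_r h1 h2). unfold h in *. lra. }
  assert (key : forall a, Rabs (x0 - a) = h ->
    (P + Derive phi x0) * (x0 - a) <= (sqrt F + e) * h).
  { intros a Ha.
    assert (L := Hmax a). rewrite Rabs_minus_sym in Ha.
    specialize (L ltac:(change (Rabs (a - x0) < d); lra)). rewrite Rabs_minus_sym in Ha.
    specialize (H1 a ltac:(lra)). specialize (H2 a ltac:(lra)). rewrite Ha in H1, H2.
    apply Rabs_le_between in H2. lra. }
  assert (K1 := key (x0 - h)). assert (K2 := key (x0 + h)).
  replace (x0 - (x0 - h)) with h in K1 by ring.
  replace (x0 - (x0 + h)) with (- h) in K2 by ring.
  rewrite Rabs_Ropp in K2. rewrite Rabs_pos_eq in K1, K2 by lra.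
  specialize (K1 eq_refl). specialize (K2 eq_refl).
  apply Rabs_le. split; apply Rmult_le_reg_r with h; lra.
Qed.

(** The system is monotone: raising one component only relaxes the constraint on the other, so in
    Perron's method each component can be improved separately. *)
Lemma slope_subsolution_mono (P : R) (V w w' v : R -> R) :
  (forall x, w x <= w' x) -> slope_subsolution P V w v -> slope_subsolution P V w' v.
Proof.
  intros Hw Hs b. destruct (Hs b) as [H0 H]. specialize (Hw b). split; [lra |].
  intros eps Heps. destruct (H eps Heps) as (h & Hh & H'). exists h; split; [exact Hh |].
  intros a Ha. apply Rle_trans with (1 := H' a Ha).
  apply Rmult_le_compat_r; [apply Rabs_pos |]. apply Rplus_le_compat_r, sqrt_le_1_alt. lra.
Qed.

(** In a pair of [S] the second member is the partner coupled to the first. A pair nearly optimal at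
    [b] satisfies the integrated inequality on the segment from [a] to [b], and its first member
    stays below [v] at [a]. *)
Lemma sup_slope_subsolution (P L : R) (V v w : R -> R) (S : (R -> R) -> (R -> R) -> Prop) :
  0 <= L -> (forall x, continuous V x) -> (forall x, continuous w x) ->
  (forall s t, S s t -> (forall x, continuous s x) /\ slope_subsolution P V t s /\
    (forall x y, Rabs (s y - s x) <= L * Rabs (y - x)) /\ forall x, t x <= w x) ->
  (forall x, is_lub (fun r => exists s t, S s t /\ r = s x) (v x)) ->
  slope_subsolution P V w v.
Proof.
  intros HL HV Hw HS Hv b.
  assert (near : forall x eta, 0 < eta -> exists s t, S s t /\ v x - eta < s x).
  { intros x eta Heta. apply NNPP. intros Hn.
    destruct (Hv x) as [_ Hlub]. specialize (Hlub (v x - eta)).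
    enough (v x <= v x - eta) by lra. apply Hlub. intros r (s & t & Hst & ->).
    apply Rnot_lt_le. intros Hlt. apply Hn. now exists s, t. }
  assert (below : forall s t x, S s t -> s x <= v x).
  { intros s t x Hst. destruct (Hv x) as [Hub _]. apply Hub. now exists s, t. }
  set (F := V b + w b - v b).
  assert (HF : 0 <= F).
  { enough (v b <= V b + w b) by (unfold F; lra).
    destruct (Hv b) as [_ Hlub]. apply Hlub. intros r (s & t & Hst & ->).
    destruct (HS s t Hst) as (_ & Hs & _ & Ht).
    destruct (Hs b) as [H0 _]. specialize (Ht b). lra. }
  split; [exact HF |]. intros eps Heps.
  (* Four errors of at most [eta] occur: the variations of [V], [w] and [s] on the segment, and the
     gap between [s b] and [v b]. They add up to [eps ^ 2], and
     [sqrt (F + eps ^ 2) <= sqrt F + eps]. *)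
  set (eta := eps ^ 2 / 4).
  assert (Heta : 0 < eta) by (unfold eta; nra).
  destruct (proj1 (continuous_eps_iff V b) (HV b) eta Heta) as (h1 & Hh1 & H1).
  destruct (proj1 (continuous_eps_iff w b) (Hw b) eta Heta) as (h2 & Hh2 & H2).
  set (h3 := eta / (L + 1)).
  assert (Hh3 : 0 < h3) by (apply Rdiv_lt_0_compat; lra).
  assert (E3 : h3 * (L + 1) = eta) by (unfold h3; field; lra).
  exists (Rmin (Rmin h1 h2) h3). split; [repeat apply Rmin_pos; assumption |].
  intros a Ha.
  assert (A1 := Rmin_l (Rmin h1 h2) h3). assert (A2 := Rmin_r (Rmin h1 h2) h3).
  assert (A3 := Rmin_l h1 h2). assert (A4 := Rmin_r h1 h2).
  apply le_epsilon. intros e He.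
  destruct (near b (Rmin e eta)) as (s & t & Hst & Hsb); [now apply Rmin_pos |].
  assert (A5 := Rmin_l e eta). assert (A6 := Rmin_r e eta).
  destruct (HS s t Hst) as (Hsc & Hss & Hlip & Htw).
  assert (main : s b - s a + P * (b - a) <= sqrt (F + eps ^ 2) * Rabs (b - a)).
  { apply (slope_subsolution_le P (F + eps ^ 2) V t s a b Hsc Hss).
    intros z Hz.
    assert (Hzb : Rabs (z - b) <= Rabs (b - a)).
    { unfold Rmin, Rmax in Hz. unfold Rabs.
      destruct (Rle_dec a b); repeat destruct Rcase_abs; lra. }
    specialize (H1 z ltac:(lra)). specialize (H2 z ltac:(lra)).
    specialize (Hlip b z). specialize (Htw z).
    assert (H4 : L * Rabs (z - b) <= eta) by (assert (T := Rabs_pos (z - b)); nra).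
    apply Rabs_def2 in H1, H2. apply Rabs_le_between in Hlip.
    unfold F. assert (eps ^ 2 = 4 * eta) by (unfold eta; field). lra. }
  assert (Hsq : sqrt (F + eps ^ 2) <= sqrt F + eps).
  { assert (T := sqrt_pos F). assert (T' := pow2_sqrt F HF).
    rewrite <- (sqrt_pow2 (sqrt F + eps)) by lra. apply sqrt_le_1_alt. nra. }
  assert (T := Rabs_pos (b - a)). specialize (below s t a Hst). nra.
Qed.

(** * Perron's method *)

Lemma periodic_Derive (f : R -> R) : periodic f -> periodic (Derive f).
Proof.
  intros Hf x. rewrite <- (Derive_ext _ _ x Hf).
  unfold Derive. f_equal. apply Lim_ext. intros h. f_equal.
  f_equal; f_equal; ring.
Qed.

(** The new function is the maximum of [v] and a raised, penalized copy [psi] of [phi]. Being a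
    strict classical subsolution near [x0], [psi] may exceed [v] there; it is kept below [v]
    elsewhere, in particular at [z]. *)
Lemma perron_bump (P : R) (V w v phi : R -> R) (x0 z : R) :
  C0_torus V -> C0_torus w -> C0_torus v -> slope_subsolution P V w v ->
  C1_torus phi -> local_min (fun x => v x - phi x) x0 ->
  (P + Derive phi x0) ^ 2 + v x0 - w x0 - V x0 < 0 ->
  (forall k : Z, z + IZR k <> x0) ->
  exists v', C0_torus v' /\ slope_subsolution P V w v' /\
    (forall x, v x <= v' x) /\ v x0 < v' x0 /\ v' z = v z.
Proof.
  intros HV Hw Hv Hs (Hpp & Hpd & Hpc) [d Hmin] Hneg Hz.
  assert (Hphi : C0_torus phi).
  { split; [exact Hpp |]. intros x. apply (ex_derive_continuous phi), Hpd. }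
  set (A := v x0 - phi x0).
  destruct (C0_torus_bounded (fun x => v x + - phi x)
    (C0_torus_plus _ _ Hv (C0_torus_opp _ Hphi))) as (B & HB & HvB).
  destruct (penalty_small_near d (cond_pos d)) as (s & Hss & Hnear).
  (* Where the penalty is at least [s], half of the penalization is at least [2 * B], which
     dominates the oscillation of [v - phi]. So half already gives a global minorant of [v], and the
     other half leaves a margin for raising [psi]. *)
  set (K := (4 * B) / s).
  assert (HK : 0 < K) by (apply Rdiv_lt_0_compat; lra).
  assert (EK : K * s = 4 * B) by (unfold K; field; lra).
  assert (below : forall x, phi x + A - K / 2 * penalty (x - x0) <= v x).
  { intros x. destruct (Rlt_dec (penalty (x - x0)) s) as [Hp | Hp].
    - destruct (Hnear x x0 Hp) as [k Hk]. specialize (Hmin (x + IZR k) Hk). simpl in Hmin.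
      rewrite (periodic_IZR v (proj1 Hv)), (periodic_IZR phi Hpp) in Hmin.
      assert (T := penalty_ge0 (x - x0)). unfold A. nra.
    - assert (B1 := HvB x). assert (B2 := HvB x0).
      apply Rabs_le_between in B1, B2. unfold A. nra. }
  set (dpsi := fun x => Derive phi x - K * (2 * PI * sin (2 * PI * (x - x0)))).
  (* The value term omits the penalization, which could only lower it. Hence [G + dl] bounds the
     cell expression of [psi] from above. *)
  set (G := fun x => (P + dpsi x) ^ 2 + (phi x + A) - w x - V x).
  assert (HG0 : G x0 < 0).
  { unfold G, dpsi, A. rewrite Rminus_diag, Rmult_0_r, sin_0. nra. }
  assert (HGp : periodic G).
  { intros x. unfold G, dpsi.
    rewrite (periodic_Derive phi Hpp), Hpp, (proj1 Hw), (proj1 HV).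
    replace (2 * PI * (x + 1 - x0)) with (2 * PI * (x - x0) + 2 * PI) by ring.
    rewrite sin_plus, cos_2PI, sin_2PI. ring. }
  assert (HGc : continuous G x0).
  { assert (Hdc : continuous (fun x => P + dpsi x) x0).
    { unfold dpsi. apply (continuous_plus (fun _ => P)); [apply continuous_const |].
      apply (continuous_minus (Derive phi)); [apply Hpc |].
      apply (ex_derive_continuous (fun x => K * (2 * PI * sin (2 * PI * (x - x0))))).
      auto_derive. exact I. }
    unfold G.
    apply (continuous_minus (fun x => (P + dpsi x) ^ 2 + (phi x + A) - w x) V); [| apply HV].
    apply (continuous_minus (fun x => (P + dpsi x) ^ 2 + (phi x + A)) w); [| apply Hw].
    apply (continuous_plus (fun x => (P + dpsi x) ^ 2) (fun x => phi x + A)).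
    - apply continuous_ext with (fun x => (P + dpsi x) * (P + dpsi x)).
      { intros x. simpl. now rewrite Rmult_1_r. }
      now apply (continuous_mult (fun x => P + dpsi x)).
    - apply (continuous_plus phi (fun _ => A)); [apply Hphi | apply continuous_const]. }
  destruct (proj1 (continuous_eps_iff G x0) HGc (- G x0 / 2) ltac:(lra)) as (r & Hr & HGr).
  destruct (penalty_small_near r Hr) as (s' & Hs' & Hnear').
  assert (Hpz : 0 < penalty (z - x0)).
  { destruct (nearest_representative z x0) as [k Hk].
    assert (T := Rabs_pos_lt (z + IZR k - x0) ltac:(specialize (Hz k); lra)).
    rewrite <- (periodic_IZR penalty penalty_periodic k).
    replace (z - x0 + IZR k) with (z + IZR k - x0) by ring.
    apply Rlt_le_trans with (penalty (Rabs (z + IZR k - x0))).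
    - apply penalty_gt0. lra.
    - apply penalty_gap; lra. }
  (* The three bounds respectively preserve the subsolution inequality where [G < G x0 / 2], confine
     [psi > v] to points with penalty below [s'], and leave the value at [z] unchanged. *)
  set (dl := Rmin (- G x0 / 2) (Rmin (K * s' / 2) (K * penalty (z - x0) / 2))).
  assert (Hdl : 0 < dl).
  { unfold dl. repeat apply Rmin_pos; try nra. }
  assert (D1 : dl <= - G x0 / 2) by apply Rmin_l.
  assert (D2 : dl <= K * s' / 2) by (eapply Rle_trans; [apply Rmin_r | apply Rmin_l]).
  assert (D3 : dl <= K * penalty (z - x0) / 2) by (eapply Rle_trans; [apply Rmin_r | apply Rmin_r]).
  set (psi := fun x => phi x + A - K * penalty (x - x0) + dl).
  assert (Dpsi : forall x, is_derive psi x (dpsi x)).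
  { intros x. unfold psi, dpsi.
    evar_last.
    - apply (is_derive_plus (fun x => phi x + A - K * penalty (x - x0)) (fun _ => dl)).
      + apply (is_derive_minus (fun x => phi x + A) (fun x => K * penalty (x - x0))).
        * apply (is_derive_plus phi (fun _ => A)); [apply Derive_correct, Hpd |].
          apply is_derive_const.
        * apply (is_derive_scal (fun x => penalty (x - x0)) x K), penalty_derive.
      + apply is_derive_const.
    - unfold minus, plus, opp, zero; simpl. ring. }
  assert (Hpsi : C0_torus psi).
  { split.
    - intros x. unfold psi. rewrite Hpp. replace (x + 1 - x0) with (x - x0 + 1) by ring.
      now rewrite penalty_periodic.
    - intros x. eapply is_derive_continuous, Dpsi. }
  exists (fun x => Rmax (v x) (psi x)).
  split; [now apply C0_torus_max_fun |]. split; [| split; [| split]].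
  (* Where [v] is the larger, the slopes of [v] bound those of the maximum; elsewhere [psi] touches
     the maximum from below. *)
  - intros b. cbv beta. destruct (Rle_dec (psi b) (v b)) as [Hb | Hb].
    + rewrite Rmax_left by exact Hb. destruct (Hs b) as [HF H]. split; [exact HF |].
      intros eps Heps. destruct (H eps Heps) as (h & Hh & H'). exists h; split; [exact Hh |].
      intros a Ha. specialize (H' a Ha). assert (T := Rmax_l (v a) (psi a)). lra.
    + assert (Hin : (P + dpsi b) ^ 2 <= V b + w b - psi b).
      { assert (Hpb : penalty (b - x0) < s').
        { specialize (below b). unfold psi in Hb. apply Rmult_lt_reg_l with K; nra. }
        destruct (Hnear' b x0 Hpb) as [k Hk]. specialize (HGr _ Hk).
        rewrite (periodic_IZR G HGp) in HGr. apply Rabs_def2 in HGr.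
        assert (T := penalty_ge0 (b - x0)).
        assert (T' : psi b <= phi b + A + dl) by (unfold psi; nra).
        unfold G in HGr at 1 3. fold (G x0) in HGr. lra. }
      rewrite Rmax_right by lra. split.
      * apply Rle_trans with (2 := Hin), pow2_ge_0.
      * intros eps Heps.
        destruct (slope_of_touching psi (fun x => Rmax (v x) (psi x)) P (dpsi b) b
          (V b + w b - psi b) (Dpsi b) Hin (Rmax_right (v b) (psi b) ltac:(lra))
          ltac:(intros; apply Rmax_r) eps Heps) as (h & Hh & H).
        exists h; split; [exact Hh |]. intros a Ha. specialize (H a Ha). simpl in H.
        rewrite (Rmax_right (v b)) in H by lra. exact H.
  - intros x. apply Rmax_l.
  - apply Rlt_le_trans with (psi x0); [| apply Rmax_r].
    unfold psi, A. rewrite Rminus_diag, penalty_0. lra.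
  - apply Rmax_left. specialize (below z). unfold psi. lra.
Qed.

(** Perron's method over pairs of subsolutions vanishing at [z]. This normalization and the common
    Lipschitz constant bound the family from above, although the system is invariant under adding
    one constant to both components. *)
Lemma cell_solvable_of_subsolution (V1 V2 s1 s2 : R -> R) (P z : R) :
  C0_torus V1 -> C0_torus V2 -> V1 z = 0 -> V2 z = 0 ->
  C0_torus s1 -> C0_torus s2 -> s1 z = 0 -> s2 z = 0 ->
  slope_subsolution P V1 s2 s1 -> slope_subsolution P V2 s1 s2 ->
  cell_solvable (quadratic_hamiltonian V1) (quadratic_hamiltonian V2) P 0.
Proof.
  intros HV1 HV2 V1z V2z Hs1 Hs2 s1z s2z Hsub1 Hsub2.
  set (S := fun s t => (C0_torus s /\ C0_torus t) /\ (s z = 0 /\ t z = 0) /\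
    slope_subsolution P V1 t s /\ slope_subsolution P V2 s t).
  destruct (C0_torus_bounded _ (C0_torus_plus V1 V2 HV1 HV2)) as (M & HM & HVM).
  set (L := sqrt M + Rabs P).
  assert (HL : 0 <= L).
  { assert (T := sqrt_pos M). assert (T' := Rabs_pos P). unfold L. lra. }
  assert (lip : forall s t, S s t -> forall x y,
    Rabs (s y - s x) <= L * Rabs (y - x) /\ Rabs (t y - t x) <= L * Rabs (y - x)).
  { intros s t ([Cs Ct] & _ & Hs & Ht) x y.
    (* The sign condition in one subsolution property bounds the other: [0 <= V2 u + s u - t u]
       gives [V1 u + t u - s u <= V1 u + V2 u <= M], and symmetrically. *)
    assert (HB : forall u, V1 u + V2 u <= M).
    { intros u. specialize (HVM u). apply Rabs_le_between in HVM. lra. }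
    split.
    - apply (slope_subsolution_lipschitz P M V1 t s); [apply Cs | exact Hs |].
      intros u. specialize (HB u). destruct (Ht u) as [T _]. lra.
    - apply (slope_subsolution_lipschitz P M V2 s t); [apply Ct | exact Ht |].
      intros u. specialize (HB u). destruct (Hs u) as [T _]. lra. }
  assert (S0 : S s1 s2) by (split; [now split | now split]).
  assert (ub : forall s t, S s t -> forall x,
    s x <= L * Rabs (x - z) /\ t x <= L * Rabs (x - z)).
  { intros s t Hst x. destruct (lip s t Hst z x) as [T1 T2].
    destruct Hst as (_ & [sz tz] & _). rewrite sz in T1. rewrite tz in T2.
    apply Rabs_le_between in T1, T2. lra. }
  assert (E1 : forall x, exists m, is_lub (fun r => exists s t, S s t /\ r = s x) m).
  { intros x. destruct (completeness (fun r => exists s t, S s t /\ r = s x)) as [m Hm].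
    - exists (L * Rabs (x - z)). intros r (s & t & Hst & ->). now apply (ub s t).
    - now exists (s1 x), s1, s2.
    - now exists m. }
  assert (E2 : forall x, exists m, is_lub (fun r => exists t s, S s t /\ r = t x) m).
  { intros x. destruct (completeness (fun r => exists t s, S s t /\ r = t x)) as [m Hm].
    - exists (L * Rabs (x - z)). intros r (t & s & Hst & ->). now apply (ub s t).
    - now exists (s2 x), s2, s1.
    - now exists m. }
  destruct (functional_choice _ E1) as [v1 Hv1].
  destruct (functional_choice _ E2) as [v2 Hv2].
  (* Stated for an arbitrary relation, so that it applies to [v2] as well, with the members of the
     pair exchanged. *)
  assert (reg : forall (v : R -> R) (T : (R -> R) -> (R -> R) -> Prop),
    (forall x, is_lub (fun r => exists s t, T s t /\ r = s x) (v x)) ->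
    (exists s t, T s t) ->
    (forall s t, T s t -> periodic s /\ s z = 0 /\
      forall x y, Rabs (s y - s x) <= L * Rabs (y - x)) ->
    C0_torus v /\ v z = 0).
  { intros v T Hv (s0 & t0 & T0) HT.
    assert (Hle : forall x y, v y <= v x + L * Rabs (y - x)).
    { intros x y. destruct (Hv y) as [_ Hlub]. apply Hlub. intros r (s & t & Hst & ->).
      destruct (HT s t Hst) as (_ & _ & Hlip). specialize (Hlip x y).
      destruct (Hv x) as [Hub _]. specialize (Hub (s x) ltac:(now exists s, t)).
      apply Rabs_le_between in Hlip. lra. }
    repeat split.
    - intros x. apply (is_lub_u _ _ _ (Hv (x + 1))).
      destruct (Hv x) as [Hub Hlub]. split.
      + intros r (s & t & Hst & ->). destruct (HT s t Hst) as (Hp & _). rewrite Hp.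
        apply Hub. now exists s, t.
      + intros m Hm. apply Hlub. intros r (s & t & Hst & ->). apply Hm.
        exists s, t. split; [exact Hst |]. destruct (HT s t Hst) as (Hp & _). now rewrite Hp.
    - intros x. apply continuous_eps_iff. intros eps Heps.
      exists (eps / (L + 1)). split; [apply Rdiv_lt_0_compat; lra |].
      intros y Hy. apply Rlt_div_r in Hy; [| lra].
      assert (T1 := Hle x y). assert (T2 := Hle y x). rewrite Rabs_minus_sym in T2.
      assert (T3 := Rabs_pos (y - x)). apply Rabs_def1; nra.
    - destruct (Hv z) as [Hub Hlub]. apply Rle_antisym.
      + apply Hlub. intros r (s & t & Hst & ->). destruct (HT s t Hst) as (_ & Hz & _). lra.
      + apply Hub. exists s0, t0. split; [exact T0 |].
        destruct (HT s0 t0 T0) as (_ & Hz & _). now symmetry. }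
  destruct (reg v1 S Hv1) as [C1 v1z].
  { now exists s1, s2. }
  { intros s t Hst. repeat split; try apply Hst. intros x y. now apply (lip s t). }
  destruct (reg v2 (fun t s => S s t) Hv2) as [C2 v2z].
  { now exists s2, s1. }
  { intros t s Hst. repeat split; try apply Hst. intros x y. now apply (lip s t). }
  assert (le1 : forall s t, S s t -> forall x, s x <= v1 x).
  { intros s t Hst x. apply (Hv1 x). now exists s, t. }
  assert (le2 : forall s t, S s t -> forall x, t x <= v2 x).
  { intros s t Hst x. apply (Hv2 x). now exists t, s. }
  assert (Sub1 : slope_subsolution P V1 v2 v1).
  { apply (sup_slope_subsolution P L V1 v1 v2 S HL); [apply HV1 | apply C2 | | exact Hv1].
    intros s t Hst. repeat split; try apply Hst.
    - intros x y. now apply (lip s t).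
    - now apply (le2 s). }
  assert (Sub2 : slope_subsolution P V2 v1 v2).
  { apply (sup_slope_subsolution P L V2 v2 v1 (fun t s => S s t) HL);
      [apply HV2 | apply C1 | | exact Hv2].
    intros t s Hst. repeat split; try apply Hst.
    - intros x y. now apply (lip s t).
    - now apply (le1 s t). }
  assert (super : forall V v w : R -> R, V z = 0 -> v z = 0 -> w z = 0 ->
    C0_torus V -> C0_torus w -> C0_torus v -> slope_subsolution P V w v ->
    (forall v', C0_torus v' -> slope_subsolution P V w v' -> (forall x, v x <= v' x) ->
      v' z = 0 -> forall x, v' x <= v x) ->
    viscosity_supersolution (cell_equation (quadratic_hamiltonian V) P 0 w) v).
  { intros V v w Vz vz wz HV Hw Hv Hs Hmax phi x0 Hphi Hmin.
    unfold cell_equation, quadratic_hamiltonian. rewrite pow2_abs.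
    destruct (classic (exists k : Z, z + IZR k = x0)) as [[k <-] | Hn].
    (* At translates of [z] only the square of the gradient remains. *)
    - rewrite (periodic_IZR v (proj1 Hv)), (periodic_IZR w (proj1 Hw)),
        (periodic_IZR V (proj1 HV)), Vz, vz, wz.
      assert (T := pow2_ge_0 (P + Derive phi (z + IZR k))). lra.
    - apply Rnot_lt_le. intros Hneg.
      destruct (perron_bump P V w v phi x0 z HV Hw Hv Hs Hphi Hmin ltac:(lra))
        as (v' & Hv' & Hs' & Hle & Hlt & Hz).
      { intros k Hk. apply Hn. now exists k. }
      specialize (Hmax v' Hv' Hs' Hle ltac:(lra) x0). lra. }
  exists v1, v2. split; [exact C1 |]. split; [exact C2 |]. split; split.
  - now apply slope_subsolution_viscosity.
  (* The improved [v'] paired with the old [v2] is again in the family by monotonicity, so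
     [v' <= v1]. *)
  - apply super; auto. intros v' Hv' Hs' Hle Hz. apply (le1 v' v2).
    split; [now split | split; [now split | split; [exact Hs' |]]].
    exact (slope_subsolution_mono P V2 v1 v' v2 Hle Sub2).
  - now apply slope_subsolution_viscosity.
  - apply super; auto. intros v' Hv' Hs' Hle Hz. apply (le2 v1 v').
    split; [now split | split; [now split | split; [| exact Hs']]].
    exact (slope_subsolution_mono P V1 v2 v' v1 Hle Sub1).
Qed.

(** * A subsolution for small [P] *)

Definition cos_pos (x : R) : R := Rmax 0 (cos (2 * PI * x)).

Lemma cos_pos_periodic : periodic cos_pos.
Proof.
  intros x. unfold cos_pos. assert (H := penalty_periodic x). unfold penalty in H.
  f_equal. lra.
Qed.

Lemma cos_pos_continuous (x : R) : continuous cos_pos x.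
Proof.
  apply (continuous_Rmax (fun _ => 0)); [apply continuous_const |].
  apply (ex_derive_continuous (fun x => cos (2 * PI * x))). auto_derive. exact I.
Qed.

Lemma cos_pos_bound (x : R) : 0 <= cos_pos x <= 1.
Proof.
  destruct (COS_bound (2 * PI * x)). unfold cos_pos. split; [apply Rmax_l |].
  apply Rmax_lub; lra.
Qed.

(** Squaring removes the corner at 0: the first-order remainder is at most [h ^ 2]. *)
Lemma sqr_Rmax0_derive (s : R) : is_derive (fun t => Rmax 0 t ^ 2) s (2 * Rmax 0 s).
Proof.
  apply is_derive_Reals. intros eps Heps. exists (mkposreal eps Heps).
  intros h Hh Hlt. simpl in Hlt.
  assert (H0 : Rabs h > 0) by now apply Rabs_pos_lt.
  assert (E : Rabs (Rmax 0 (s + h) ^ 2 - Rmax 0 s ^ 2 - 2 * Rmax 0 s * h) <= Rabs h * Rabs h).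
  { rewrite <- Rabs_mult, (Rabs_pos_eq (h * h)) by nra. apply Rabs_le.
    unfold Rmax. repeat destruct Rle_dec; nra. }
  replace ((Rmax 0 (s + h) ^ 2 - Rmax 0 s ^ 2) / h - 2 * Rmax 0 s)
    with ((Rmax 0 (s + h) ^ 2 - Rmax 0 s ^ 2 - 2 * Rmax 0 s * h) / h) by (field; exact Hh).
  rewrite Rabs_div by exact Hh. apply Rlt_div_l; nra.
Qed.

Lemma sqr_cos_pos_derive (x : R) :
  is_derive (fun x => cos_pos x ^ 2) x (- (4 * PI * cos_pos x * sin (2 * PI * x))).
Proof.
  unfold cos_pos.
  evar_last.
  - apply (is_derive_comp (fun t => Rmax 0 t ^ 2) (fun x => cos (2 * PI * x))).
    + apply sqr_Rmax0_derive.
    + instantiate (1 := - (2 * PI * sin (2 * PI * x))). auto_derive; [exact I | ring].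
  - unfold scal; simpl. unfold mult; simpl. ring.
Qed.

(** Based at [1 / 2] so that the subsolution built from it vanishes at the zero of the
    potentials. *)
Definition cos_pos_primitive (x : R) : R := RInt cos_pos (1 / 2) x.

Lemma cos_pos_primitive_derive (x : R) : is_derive cos_pos_primitive x (cos_pos x).
Proof.
  apply (is_derive_RInt cos_pos cos_pos_primitive (1 / 2)); [| apply cos_pos_continuous].
  exists (mkposreal 1 Rlt_0_1). intros y _. apply (RInt_correct cos_pos).
  apply (ex_RInt_continuous cos_pos). intros t _. apply cos_pos_continuous.
Qed.

Definition cos_pos_mass : R := cos_pos_primitive (3 / 2).

Lemma cos_pos_primitive_shift (x : R) :
  cos_pos_primitive (x + 1) = cos_pos_primitive x + cos_pos_mass.
Proof.
  assert (D : forall y, is_derive (fun t => cos_pos_primitive (t + 1) - cos_pos_primitive t) y 0).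
  { intros y. evar_last.
    - apply (is_derive_minus (fun t => cos_pos_primitive (t + 1)) cos_pos_primitive).
      + apply (is_derive_comp cos_pos_primitive (fun t => t + 1)).
        * apply cos_pos_primitive_derive.
        * instantiate (1 := 1). auto_derive; [exact I | ring].
      + apply cos_pos_primitive_derive.
    - rewrite cos_pos_periodic. unfold minus, plus, opp, scal; simpl. unfold mult; simpl. ring. }
  destruct (MVT_gen (fun t => cos_pos_primitive (t + 1) - cos_pos_primitive t) (1 / 2) x
    (fun _ => 0)) as (c & _ & Hc).
  - intros y _. apply D.
  - intros y _. apply continuous_continuity_pt. eapply is_derive_continuous, D.
  - unfold cos_pos_mass. replace (3 / 2) with (1 / 2 + 1) by field.
    assert (E : cos_pos_primitive (1 / 2) = 0) by (apply (RInt_point (1 / 2) cos_pos)).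
    lra.
Qed.

(** With zero mass the monotone primitive would be constant on [[1/2, 3/2]], contradicting its
    derivative 1 at the point 1. *)
Lemma cos_pos_mass_gt0 : 0 < cos_pos_mass.
Proof.
  assert (mono : forall x y, x <= y -> cos_pos_primitive x <= cos_pos_primitive y).
  { intros x y Hxy.
    destruct (MVT_gen cos_pos_primitive x y cos_pos) as (c & _ & Hc).
    - intros t _. apply cos_pos_primitive_derive.
    - intros t _. apply continuous_continuity_pt.
      eapply is_derive_continuous, cos_pos_primitive_derive.
    - destruct (cos_pos_bound c). nra. }
  assert (E : cos_pos_primitive (1 / 2) = 0) by (apply (RInt_point (1 / 2) cos_pos)).
  destruct (Rle_lt_or_eq_dec 0 cos_pos_mass) as [H | H]; [| exact H |].
  { rewrite <- E. apply mono. lra. }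
  exfalso.
  assert (D : is_derive cos_pos_primitive 1 0).
  { apply is_derive_ext_loc with (fun _ => 0); [| apply @is_derive_const].
    exists (mkposreal (1 / 2) ltac:(lra)). intros t Ht.
    change (Rabs (t - 1) < 1 / 2) in Ht. apply Rabs_def2 in Ht.
    assert (T1 := mono (1 / 2) t ltac:(lra)). assert (T2 := mono t (3 / 2) ltac:(lra)).
    unfold cos_pos_mass in H. lra. }
  assert (U := is_derive_unique _ _ _ (cos_pos_primitive_derive 1)).
  rewrite (is_derive_unique _ _ _ D) in U. unfold cos_pos in U.
  rewrite Rmult_1_r, cos_2PI in U. assert (T := Rmax_r 0 1). lra.
Qed.

Lemma cos_pos_gt0_near (x : R) :
  0 < cos_pos x -> exists k : Z, Rabs (x + IZR k) <= 1 / 4.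
Proof.
  intros H. destruct (nearest_representative x 0) as [k Hk]. exists k.
  rewrite Rminus_0_r in Hk. apply Rnot_lt_le. intros Hc.
  assert (T := penalty_gap (1 / 4) (x + IZR k) ltac:(lra) ltac:(lra)).
  rewrite <- (periodic_IZR cos_pos cos_pos_periodic k) in H.
  unfold penalty in T. replace (2 * PI * (1 / 4)) with (PI / 2) in T by field.
  rewrite cos_PI2 in T. unfold cos_pos in H. rewrite Rmax_left in H; lra.
Qed.

(** * Choice of the constants and the explicit pair *)

Theorem theorem4p17 (V1 V2 : R -> R)
  (hV1 : C0_torus V1) (hV2 : C0_torus V2)
  (V1_zero : forall x : R, V1 x = 0)
  (V2_ge0 : forall x : R, 0 <= x <= 1 -> 0 <= V2 x)
  (V2_zero : forall x : R, 0 <= x <= 1 -> (V2 x = 0 <-> x = 1 / 2)) :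
  exists gamma : R, 0 < gamma /\
    forall P : R, Rabs P <= gamma ->
      effective_hamiltonian_is
        (quadratic_hamiltonian V1) (quadratic_hamiltonian V2) P 0.
Proof.
  assert (V2_pos : forall x, Rabs x <= 1 / 4 -> 0 < V2 x).
  { intros x Hx. apply Rabs_le_between in Hx. destruct (Rle_dec 0 x) as [H | H].
    - destruct (V2_ge0 x ltac:(lra)) as [T | T]; [exact T |].
      symmetry in T. apply V2_zero in T; lra.
    - rewrite <- (proj1 hV2). destruct (V2_ge0 (x + 1) ltac:(lra)) as [T | T]; [exact T |].
      symmetry in T. apply V2_zero in T; lra. }
  assert (V2_nonneg : forall x, 0 <= V2 x).
  { intros x. destruct (nearest_representative x (1 / 2)) as [k Hk].
    rewrite <- (periodic_IZR V2 (proj1 hV2) k). apply V2_ge0.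
    apply Rabs_le_between in Hk. lra. }
  destruct (continuity_ab_min V2 (- (1 / 4)) (1 / 4) ltac:(lra)
    ltac:(intros; apply continuous_continuity_pt, hV2)) as (a & Ha & Hab).
  set (m := V2 a) in *.
  assert (Hm : 0 < m) by (apply V2_pos, Rabs_le; lra).
  (* Here [290 = 17 ^ 2 + 1]. With [PI <= 4] and [kap <= 1], the gradient factor [r] below is at
     most [kap + 16 * kap] in absolute value, and the coupling costs one more [kap ^ 2]; then
     [290 * kap ^ 2 <= 290 * kap <= m]. *)
  set (kap := Rmin 1 (m / 290)).
  assert (Hkap : 0 < kap) by (apply Rmin_pos; lra).
  assert (Hkap1 : kap <= 1) by apply Rmin_l.
  assert (Hkapm : kap <= m / 290) by apply Rmin_r.
  assert (Hmu := cos_pos_mass_gt0).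
  exists (kap * cos_pos_mass). split; [nra |]. intros P HP.
  enough (H0 : cell_solvable (quadratic_hamiltonian V1) (quadratic_hamiltonian V2) P 0).
  { split; [exact H0 |]. intros c Hc.
    apply Rle_antisym; [apply (cell_constant_le V1 V2 P c 0) |
      apply (cell_constant_le V1 V2 P 0 c)]; assumption. }
  set (q := P / cos_pos_mass).
  assert (Hq : Rabs q <= kap).
  { unfold q. rewrite Rabs_div, (Rabs_pos_eq cos_pos_mass) by lra. apply Rle_div_l; lra. }
  assert (Hq2 : q ^ 2 <= kap ^ 2) by now apply pow_maj_Rabs.
  (* Dividing [P] by the mass makes [s1] periodic: the gain [q * cos_pos_mass] over one period
     cancels [P]. *)
  set (s1 := fun x => q * cos_pos_primitive x - P * (x - 1 / 2)).
  set (s2 := fun x => s1 x + kap ^ 2 * cos_pos x ^ 2).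
  assert (D1 : forall x, is_derive s1 x (q * cos_pos x - P)).
  { intros x. evar_last.
    - apply (is_derive_minus (fun x => q * cos_pos_primitive x) (fun x => P * (x - 1 / 2))).
      + apply (is_derive_scal cos_pos_primitive x q), cos_pos_primitive_derive.
      + instantiate (1 := P). auto_derive; [exact I | ring].
    - unfold minus, plus, opp; simpl. ring. }
  assert (D2 : forall x, is_derive s2 x
    (q * cos_pos x - P - 4 * PI * kap ^ 2 * cos_pos x * sin (2 * PI * x))).
  { intros x. evar_last.
    - apply (is_derive_plus s1 (fun x => kap ^ 2 * cos_pos x ^ 2)); [apply D1 |].
      apply (is_derive_scal (fun x => cos_pos x ^ 2) x (kap ^ 2)), sqr_cos_pos_derive.
    - unfold plus; simpl. ring. }
  assert (C1 : C0_torus s1).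
  { split; [| intros x; eapply is_derive_continuous, D1].
    intros x. unfold s1. rewrite cos_pos_primitive_shift.
    replace P with (q * cos_pos_mass) by (unfold q; field; lra). ring. }
  assert (C2 : C0_torus s2).
  { split; [| intros x; eapply is_derive_continuous, D2].
    intros x. unfold s2. now rewrite (proj1 C1), cos_pos_periodic. }
  assert (s1_half : s1 (1 / 2) = 0).
  { unfold s1. replace (cos_pos_primitive (1 / 2)) with 0; [ring |].
    symmetry. apply (RInt_point (1 / 2) cos_pos). }
  assert (s2_half : s2 (1 / 2) = 0).
  { unfold s2, cos_pos. rewrite s1_half. replace (2 * PI * (1 / 2)) with PI by field.
    rewrite cos_PI, Rmax_left by lra. ring. }
  apply (cell_solvable_of_subsolution V1 V2 s1 s2 P (1 / 2)); auto.
  - now apply V2_zero; [lra |].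
  (* The inequality is [(q * cos_pos x) ^ 2 <= kap ^ 2 * cos_pos x ^ 2]: the gap between [s2] and
     [s1] pays for the gradient where [V1] gives nothing. *)
  - apply (classical_slope_subsolution P V1 s2 s1 _ D1). intros x.
    rewrite V1_zero. unfold s2. assert (T := pow2_ge_0 (cos_pos x)). nra.
  - apply (classical_slope_subsolution P V2 s1 s2 _ D2). intros x.
    unfold s2. destruct (cos_pos_bound x) as [H0 H1].
    destruct (Rle_lt_or_eq_dec _ _ H0) as [Hc | Hc].
    (* Where the truncated cosine vanishes, so do the total gradient and the coupling, and
       [0 <= V2 x] suffices. *)
    2:{ rewrite <- Hc. specialize (V2_nonneg x). nra. }
    assert (HV : m <= V2 x).
    { destruct (cos_pos_gt0_near x Hc) as [k Hk].
      rewrite <- (periodic_IZR V2 (proj1 hV2) k). apply Ha. now apply Rabs_le_between. }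
    set (r := q - 4 * PI * kap ^ 2 * sin (2 * PI * x)).
    assert (Hr : r ^ 2 <= 289 * kap ^ 2).
    { apply Rle_trans with ((17 * kap) ^ 2); [| lra].
      apply pow_maj_Rabs. apply Rabs_le_between in Hq.
      destruct (SIN_bound (2 * PI * x)). assert (HPI := PI_RGT_0). assert (HPI4 := PI_4).
      assert (0 <= PI * kap ^ 2 <= 4 * kap) by nra.
      apply Rabs_le. unfold r. nra. }
    replace (P + (q * cos_pos x - P - 4 * PI * kap ^ 2 * cos_pos x * sin (2 * PI * x)))
      with (r * cos_pos x) by (unfold r; ring).
    assert (Hc2 : 0 <= cos_pos x ^ 2 <= 1) by nra.
    assert (Hr0 := pow2_ge_0 r).
    assert (E : (r * cos_pos x) ^ 2 = r ^ 2 * cos_pos x ^ 2) by ring.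
    rewrite E. assert (r ^ 2 * cos_pos x ^ 2 <= r ^ 2) by nra.
    assert (kap ^ 2 * cos_pos x ^ 2 <= kap ^ 2) by nra.
    assert (kap ^ 2 <= kap) by nra. lra.
Qed.
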